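(* Let $\mathcal{T}$ be a tangle whose topological class $\mathcal{G}(\mathcal{T})$ contains at least one non-Hamiltonian multigraph. Then there exists a positive integer $n_1$ such that for all integers $n>n_1$ and $k\ge1$, eventually all of the graphs in $\mathcal{G}(\mathcal{T})$ fail to guarantee contiguous EF$k_{\mathrm{outer}}$ allocations for $n$ agents with monotone valuations.
   Context: A tangle is a connected topological space obtained by taking finitely many disjoint copies of $[0,1]$ and identifying some of their endpoints (quotient topology). Points of degree $1$ or $\ge3$ (degree = number of rays from the point in a small neighborhood) are singular; an edge is a connected component of the complement of the singular points. The multigraph $G_{\mathcal{T}}$ has the singular points as vertices and one edge for each edge of $\mathcal{T}$ joining the singular points at its ends (loops and parallel edges allowed). A subdivision of a multigraph is obtained by inserting zero or more new degree-$2$ vertices along edges; the topological class $\mathcal{G}(\mathcal{T})$ is the collection of all subdivisions of $G_{\mathcal{T}}$. $H\succeq G$ means $H$ is isomorphic to a subdivision of $G$. A property holds for eventually all members of $\mathcal{G}(\mathcal{T})$ if the set of members having it contains $\{K\in\mathcal{G}(\mathcal{T}):K\succeq H\}$ for some $H\in\mathcal{G}(\mathcal{T})$. A multigraph is Hamiltonian (traceable) if it has a path visiting every vertex exactly once. For a (multi)graph $G=(V,E)$ and $n$ agents, each agent $i$ has a monotone valuation $\nu_i$ on subsets of $V$ ($\nu_i(\emptyset)=0$, $\nu_i(X)\le\nu_i(Y)$ for $X\subseteq Y$). A contiguous allocation is a tuple $(A_1,\dots,A_n)$ of pairwise disjoint subsets of $V$ with union $V$, each inducing a connected subgraph. It is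 EF$k_{\mathrm{outer}}$ if for every $i\ne j$ there is $S\subseteq A_j$ with $|S|\le k$ such that $A_j\setminus S$ induces a connected subgraph and $\nu_i(A_i)\ge\nu_i(A_j\setminus S)$. $G$ guarantees contiguous EF$k_{\mathrm{outer}}$ allocations for $n$ agents if such an allocation exists for every choice of monotone valuations $\nu_1,\dots,\nu_n$. *)

(* Defs.v *)
From HB Require Import structures.
From mathcomp Require Import all_boot all_order all_algebra.
From mathcomp Require Import all_classical all_reals all_analysis.

Set Implicit Arguments.
Unset Strict Implicit.
Unset Printing Implicit Defensive.

Import Order.TTheory GRing.Theory Num.Theory.
Import numFieldNormedType.Exports.

Local Open Scope classical_set_scope.
Local Open Scope ring_scope.

(* A finite multigraph: an edge is a point of its own type, so loops and
   parallel edges are allowed.  The order inside [ends e] carries no meaning;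
   everything below goes through the symmetric relation [joins]. *)
Record mgraph := MGraph {
  vert : finType;
  edge : finType;
  ends : edge -> vert * vert }.

Definition joins (G : mgraph) (e : edge G) (u v : vert G) : bool :=
  (ends e == (u, v)) || (ends e == (v, u)).

Definition adj (G : mgraph) : rel (vert G) :=
  fun u v => [exists e : edge G, joins e u v].

Definition mgraph_iso (G H : mgraph) : Prop :=
  exists (fv : vert G -> vert H) (fe : edge G -> edge H),
    [/\ bijective fv, bijective fe &
        forall e u v, joins (fe e) (fv u) (fv v) = joins e u v].

Definition loop_graph : mgraph := @MGraph unit unit (fun _ => (tt, tt)).

Section Subdivision.
Variables (G : mgraph) (s : edge G -> nat).

(* [s e] new vertices are inserted along the edge [e], which becomes a path of
   [(s e).+1] edges. *)
Definition subdiv_vert : finType := (vert G + {e : edge G & 'I_(s e)})%type.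
Definition subdiv_edge : finType := {e : edge G & 'I_(s e).+1}.

(* The points 0, 1, ..., (s e).+1 of that path: point 0 is the first end of
   [e], the points 1, ..., s e are new, and the last one is the second end. *)
Definition subdiv_point (e : edge G) (i : nat) : subdiv_vert :=
  match i with
  | 0%N => inl (ends e).1
  | j.+1 => if insub j is Some k then inr (existT (fun e => 'I_(s e)) e k)
            else inl (ends e).2
  end.

Definition subdiv_ends (a : subdiv_edge) : subdiv_vert * subdiv_vert :=
  (subdiv_point (tag a) (tagged a), subdiv_point (tag a) (tagged a).+1).

Definition subdivide : mgraph := MGraph subdiv_ends.
End Subdivision.

(* [K] is isomorphic to a subdivision of [G]. *)
Definition subdivides (K G : mgraph) : Prop :=
  exists s : edge G -> nat, mgraph_iso K (subdivide s).

(* Hamiltonian is meant in the sense of paths, not of cycles. *)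
Definition hamiltonian (G : mgraph) : Prop :=
  exists (x : vert G) (p : seq (vert G)),
    [/\ path (@adj G) x p, uniq (x :: p) & forall v, v \in x :: p].

Section Tangles.
Variables (R : realType) (T : topologicalType).

(* [q] exhibits the subset [A] of [T] as the quotient of [m] disjoint copies of
   [J] in which only points of [E] are identified.  The last condition says that
   [A] is open in [T] and carries the quotient topology. *)
Definition glued_from (J E : set R) (m : nat) (q : 'I_m -> R -> T) (A : set T)
    : Prop :=
  [/\ A = \bigcup_i (q i @` J),
      forall i j s t, J s -> J t -> q i s = q j t ->
        (i = j /\ s = t) \/ (E s /\ E t) &
      forall U : set T, U `<=` A ->
        (open U <-> forall i, open (q i @^-1` U : set (subspace J)))].

Definition is_tangle : Prop :=
  [/\ [set: T] !=set0,
      connected [set: T] &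
      exists (m : nat) (q : 'I_m -> R -> T),
        glued_from `[0, 1] [set 0; 1] q [set: T]].

(* Some neighborhood of [x] is a star made of [d] rays [0, 1) issuing from
   [x]. *)
Definition has_degree (x : T) (d : nat) : Prop :=
  exists (r : 'I_d -> R -> T) (A : set T),
    [/\ A x, forall i, r i 0 = x & glued_from `[0, 1[ [set 0] r A].

Definition singular : set T :=
  [set x | exists2 d, has_degree x d & (d == 1)%N || (3 <= d)%N].

Definition tangle_edges : set (set T) :=
  connected_component (~` singular) @` (~` singular).

(* [G] is (a copy of) the multigraph of [T].  The ends of a tangle edge [C] are
   the points of [closure C `\` C], a single point if [C] is a loop.  The
   circle is the one tangle without singular points; its only edge has no end,
   and its multigraph is taken to be one vertex with a loop, so that its
   topological class consists of all cycles. *)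
Definition multigraph_of (G : mgraph) : Prop :=
  (singular = set0 /\ mgraph_iso G loop_graph) \/
  exists (fv : vert G -> T) (fe : edge G -> set T),
    [/\ set_bij [set: vert G] singular fv,
        set_bij [set: edge G] tangle_edges fe &
        forall e, closure (fe e) `\` fe e =
                  [set fv (ends e).1; fv (ends e).2]].

Definition topological_class (K : mgraph) : Prop :=
  exists2 G, multigraph_of G & subdivides K G.

Definition eventually_all (P : mgraph -> Prop) : Prop :=
  exists2 H, topological_class H &
    forall K, topological_class K -> subdivides K H -> P K.
End Tangles.

Section FairDivision.
Variables (R : realType) (G : mgraph) (n : nat).

(* The empty set is connected: agents may receive nothing, and a whole bundle
   may be removed. *)
Definition connected_in (X : {set vert G}) : bool :=
  [forall u in X, forall v in X,
     connect [rel a b | [&& adj a b, a \in X & b \in X]] u v].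

Definition monotone_valuation (nu : {set vert G} -> R) : Prop :=
  nu finset.set0 = 0 /\ forall X Y : {set vert G}, X \subset Y -> nu X <= nu Y.

Definition contiguous_allocation (A : 'I_n -> {set vert G}) : Prop :=
  [/\ forall i j, i != j -> (A i :&: A j)%SET = finset.set0,
      forall v, exists i, v \in A i &
      forall i, connected_in (A i)].

Definition EFk_outer (k : nat) (nu : 'I_n -> {set vert G} -> R)
    (A : 'I_n -> {set vert G}) : Prop :=
  forall i j, i != j -> exists S : {set vert G},
    [/\ S \subset A j, (#|S| <= k)%N,
        connected_in (A j :\: S)%SET & nu i (A j :\: S)%SET <= nu i (A i)].

Definition guarantees_EFk_outer (k : nat) : Prop :=
  forall nu : 'I_n -> {set vert G} -> R,
    (forall i, monotone_valuation (nu i)) ->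
    exists A, contiguous_allocation A /\ EFk_outer k nu A.
End FairDivision.

(* Main.v *)
(* Let G be the multigraph of the tangle, with E edges, V vertices and l leaves.
   An edge count along a longest path shows that a connected multigraph with
   E - V + l <= 1 has a Hamiltonian path; since E - V + l is invariant under
   subdivision and G is connected, E >= (V - l) + 2.  Give n identical agents
   the valuation counting marked vertices, all marks lying inside edges of G.
   By averaging, the EFk condition forces every bundle to hold at least t marks,
   where t is about the average minus k.  At most V - l bundles contain a
   non-leaf vertex of G; every other bundle lives on a single edge.  If the edge
   e carries (p e + 1) t - 1 marks, at most p e of them live on e.  With
   sum_e p e = n - 1 - (V - l), there are too few bundles, while for large t the
   total number of marks, about (n - 1 - (V - l) + E) t >= (n + 1) t, is large
   enough for the averaging. *)
Require Import Defs.
From mathcomp Require Import all_boot all_order all_algebra.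
From mathcomp Require Import all_classical all_reals all_analysis.
From mathcomp Require Import zify.

Set Implicit Arguments.
Unset Strict Implicit.
Unset Printing Implicit Defensive.

Import Order.TTheory GRing.Theory Num.Theory.
Import numFieldNormedType.Exports.

(** * Incidence, degree and the edges of a path *)

(** A loop counts twice at its vertex, so every edge contributes exactly two to the degree sum. *)
Definition incidence (G : mgraph) (e : edge G) (v : vert G) : nat :=
  ((ends e).1 == v) + ((ends e).2 == v).

Definition degree (G : mgraph) (v : vert G) : nat := \sum_e incidence e v.

Definition low_degree (G : mgraph) : {set vert G} := [set v | degree v <= 1].

Lemma degree_low_ge2 (G : mgraph) (v : vert G) :
  2 <= degree v + 2 * (v \in low_degree G).
Proof. by rewrite inE; case: (leqP (degree v) 1) => //= h; lia. Qed.

Lemma adj_sym (G : mgraph) : symmetric (@adj G).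
Proof. by move=> u v; apply: eq_existsb => e; rewrite /joins orbC. Qed.

Lemma joins_adj (G : mgraph) (e : edge G) u v : joins e u v -> adj u v.
Proof. by move=> h; apply/existsP; exists e. Qed.

Lemma adj_ends (G : mgraph) (e : edge G) : adj (ends e).1 (ends e).2.
Proof. by apply: (@joins_adj _ e); rewrite /joins -surjective_pairing eqxx. Qed.

Lemma joins_incidence (G : mgraph) (e : edge G) u v :
  joins e u v -> 0 < incidence e u.
Proof.
by rewrite /joins /incidence; case/orP=> /eqP -> /=; rewrite eqxx ?addn1.
Qed.

Lemma incidence_joins (G : mgraph) (e : edge G) u :
  0 < incidence e u -> exists v, joins e u v.
Proof.
rewrite /joins /incidence; case: (ends e) => a b /=.
case: eqP => [->|_]; first by exists b; rewrite eqxx.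
by case: eqP => [->|//]; exists a; rewrite eqxx orbT.
Qed.

Lemma joins2_adj (G : mgraph) (e : edge G) u v :
  0 < incidence e u -> 0 < incidence e v -> u != v -> adj u v.
Proof.
move=> iu iv uv; apply: (@joins_adj _ e); rewrite /joins.
move: iu iv; rewrite /incidence; case: (ends e) => a b /=.
by do 4?[case: eqP => [?|_] //=]; subst; rewrite ?eqxx ?orbT // in uv *.
Qed.

Lemma sum_incidence (G : mgraph) (B : {set vert G}) e :
  \sum_(v in B) incidence e v = ((ends e).1 \in B) + ((ends e).2 \in B).
Proof.
have h (x : vert G) : \sum_(v in B) ((x == v) : nat) = (x \in B).
  case xB: (x \in B).
    rewrite (bigD1 x) //= eqxx big1 ?addn0 // => v /andP[_ /negbTE].
    by rewrite eq_sym => ->.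
  by apply: big1 => v vB; case: eqP => // xv; rewrite xv vB in xB.
by rewrite big_split /= !h.
Qed.

Lemma handshake (G : mgraph) : \sum_(v : vert G) degree v = #|edge G| * 2.
Proof.
rewrite exchange_big -sum_nat_const; apply: eq_bigr => e _.
transitivity (\sum_(v in [set: vert G]%SET) incidence e v).
  by apply: eq_bigl => v; rewrite inE.
by rewrite sum_incidence !inE.
Qed.

(** One edge is picked for each step of the path. The bounds at the two end vertices are what later
    leaves room there for an edge outside [F]. *)
Lemma path_edges (G : mgraph) (x : vert G) p :
  path (@adj G) x p -> uniq (x :: p) ->
  exists F : {set edge G},
    [/\ #|F| = size p,
        forall e, e \in F -> ((ends e).1 \in x :: p) && ((ends e).2 \in x :: p),
        \sum_(e in F) incidence e x <= 1 &
        \sum_(e in F) incidence e (last x p) <= 1].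
Proof.
elim: p x => [|y p IH] x /=.
  move=> _ _; exists finset.set0.
  by split; rewrite ?cards0 ?big_set0 // => e; rewrite inE.
case/andP=> /existsP[a jxy] pyp /andP[xnyp uyp].
have [F [cF endF hF lF]] := IH y pyp uyp.
have aF : a \notin F.
  apply/negP => /endF; case/orP: jxy => /eqP -> /=;
  by rewrite (negbTE xnyp) ?andbF.
have xF e : e \in F -> incidence e x = 0.
  move/endF => /andP[h1 h2]; rewrite /incidence.
  by do 2![case: eqP => [E|_]; first by rewrite -E ?h1 ?h2 in xnyp].
have iav v : incidence a v = (v == x) + (v == y).
  rewrite /incidence; case/orP: jxy => /eqP -> /=; rewrite ![v == _]eq_sym //.
  by rewrite addnC.
have xy : (x == y) = false by move: xnyp; rewrite inE; case: eqP.
exists (a |: F)%SET; split.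
- by rewrite cardsU1 aF cF.
- move=> e; rewrite !inE => /orP[/eqP ->|/endF].
    by case/orP: jxy => /eqP -> /=; rewrite !eqxx ?orbT.
  by rewrite !inE => /andP[-> ->]; rewrite !orbT.
- by rewrite big_setU1 //= iav eqxx xy big1 // => e /xF.
rewrite big_setU1 //= iav.
have lx : (last y p == x) = false.
  by apply/eqP => E; rewrite -E mem_last in xnyp.
(* The new edge [a] touches the last vertex only if that vertex is [y]; then [p] is empty, so [F] is
   empty too and [a] alone is counted. *)
rewrite lx; case: eqP => [E|_] //=.
have : p = [::].
  by case: p E uyp {IH pyp cF endF hF lF xnyp lx} => //= z p <-; rewrite mem_last.
move=> p0; move: cF; rewrite p0 /= => /eqP; rewrite cards_eq0 => /eqP ->.
by rewrite big_set0.
Qed.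

(** A vertex of degree at least two that meets [F] at most once has an incident edge outside [F],
    and the other end of that edge is a neighbour, hence in [P]. For a vertex of low degree, [A] is
    empty and the indicator makes up for it. *)
Lemma extra_edge (G : mgraph) (P : seq (vert G)) (F : {set edge G}) x :
  x \in P -> (forall z, adj x z -> z \in P) -> \sum_(e in F) incidence e x <= 1 ->
  exists A : {set edge G},
    [/\ [disjoint A & F], 1 <= #|A| + (x \in low_degree G) &
        forall e, e \in A -> 0 < incidence e x /\
          ((ends e).1 \in P) && ((ends e).2 \in P)].
Proof.
move=> xP nP sF; case: (boolP (x \in low_degree G)) => [xl|].
  exists finset.set0; split => [| |e]; rewrite ?addn1 ?inE //.
  by rewrite finset.disjoints_subset finset.sub0set.
rewrite inE -ltnNge => dx.
have [e eF ex] : exists2 e, e \notin F & 0 < incidence e x.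
  apply: contrapT => nex; move: dx; rewrite ltnNge => /negP; apply.
  apply: leq_trans sF; rewrite /degree (bigID (mem F)) /= [X in _ + X]big1 ?addn0 //.
  by move=> e eF; have [//|ex] := posnP (incidence e x); case: nex; exists e.
exists [set e]; split => [||f]; rewrite ?cards1 ?disjoints1 //.
rewrite inE => /eqP ->; split => //.
have [z jz] := incidence_joins ex.
have zP := nP z (joins_adj jz).
by case/orP: jz => /eqP -> /=; rewrite xP zP.
Qed.

(** * Longest paths in a connected graph *)

Definition connected_graph (G : mgraph) : Prop :=
  forall u v : vert G, connect (@adj G) u v.

Lemma leave_edge (G : mgraph) (P : seq (vert G)) u w :
  connected_graph G -> u \in P -> w \notin P ->
  exists v z, [/\ v \in P, z \notin P & adj v z].
Proof.
move=> cG Pu Pw; apply: contrapT => h; move: Pw; apply/negP/negPn.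
case/connectP: (cG u w) => p pp ->; elim: p u Pu pp => //= y p IH u Pu /andP[uy yp].
apply: IH yp; apply: contrapT => /negP Py; apply: h; exists u, y; split => //.
Qed.

Section LongestPath.
Variables (G : mgraph) (x : vert G) (p : seq (vert G)).
Hypotheses (cG : connected_graph G) (xp : path (@adj G) x p) (up : uniq (x :: p)).
Hypothesis longest : forall y q, path (@adj G) y q -> uniq (y :: q) -> size q <= size p.

Let head_closed z : adj x z -> z \in x :: p.
Proof.
move=> xz; apply: contrapT => /negP zp.
have := longest (y := z) (q := x :: p); rewrite [uniq _]/= -/(uniq (x :: p)) up zp.
by rewrite [path _ _ _]/= adj_sym xz xp ltnn => /(_ isT isT).
Qed.

Let last_closed z : adj (last x p) z -> z \in x :: p.
Proof.
move=> lz; apply: contrapT => /negP zp.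
have := longest (y := x) (q := rcons p z); rewrite rcons_path xp lz.
by rewrite -rcons_cons rcons_uniq zp up size_rcons ltnn => /(_ isT isT).
Qed.

(** Adjacent ends would close the path into a cycle; cutting the cycle open at a vertex with a
    neighbour [z] off the path and prepending [z] gives a longer path. *)
Let not_cycle w : w \notin x :: p -> ~~ adj (last x p) x.
Proof.
move=> wp; apply/negP => lx.
have [v [z [vp zp vz]]] := leave_edge cG (mem_head x p) wp.
have cyc : cycle (@adj G) (x :: p) by rewrite /= rcons_path xp.
have [i s rs] := rot_to vp.
have cs : cycle (@adj G) (v :: s) by rewrite -rs rot_cycle.
have us : uniq (v :: s) by rewrite -rs rot_uniq.
have zs : z \notin v :: s by rewrite -rs mem_rot.
have ss : size s = size p by have := congr1 size rs; rewrite size_rot /= => -[].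
have := longest (y := z) (q := v :: s); rewrite [uniq _]/= -/(uniq (v :: s)) us zs.
move: cs; rewrite /= rcons_path => /andP[-> _].
by rewrite adj_sym vz ss ltnn => /(_ isT isT).
Qed.

(* If a longest path misses a vertex, it has an edge leaving it from an
   interior vertex, and each of its two ends either has degree at most one or
   carries an edge inside the path that is not an edge of the path. *)
Lemma longest_path_excess w : w \notin x :: p ->
  #|vert G| + 2 <= #|edge G| + #|low_degree G|.
Proof.
move=> wp.
have [v [z [vp zp vz]]] := leave_edge cG (mem_head x p) wp.
have nlx := not_cycle wp.
have [F [cF endF hF lF]] := path_edges xp up.
have [A [AF cA endA]] := extra_edge (mem_head x p) head_closed hF.
have [B [BF cB endB]] := extra_edge (mem_last x p) last_closed lF.
(* With equal ends the path is a single vertex, and the edge leaving it contradicts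
   [head_closed]. *)
have xl : x != last x p.
  apply/eqP => E.
  have p0 : p = [::] by case: p E up => //= a q ->; rewrite mem_last.
  move: vp zp vz; rewrite p0 mem_seq1 => /eqP -> zx xz.
  by move: zx; rewrite -p0 head_closed.
(* A common edge would join the two ends of the path, which [not_cycle] forbids. *)
have AB : [disjoint A & B].
  apply/pred0P => e /=; apply/negP => /andP[/endA[ex _] /endB[el _]].
  by move: nlx; rewrite (joins2_adj el ex) // eq_sym.
pose P : {set vert G} := [set u in x :: p].
have cP : #|P| = (size p).+1 by rewrite cardsE; apply: card_uniqP.
(* [c e] counts the ends of [e] on the path: two for the edges of [U], one for the edge [a] that
   leaves the path. *)
pose c e := \sum_(u in P) incidence e u.
have dP : \sum_(u in P) degree u = \sum_e c e by rewrite /degree exchange_big.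
pose U := (F :|: A :|: B)%SET.
have cU : #|U| = size p + #|A| + #|B|.
  rewrite /U !cardsU cF.
  have -> : (F :&: A)%SET = finset.set0 by apply/eqP; rewrite finset.setI_eq0 disjoint_sym.
  have -> : ((F :|: A) :&: B)%SET = finset.set0.
    apply/eqP; rewrite finset.setI_eq0 finset.disjoints_subset finset.subUset.
    by rewrite -!finset.disjoints_subset disjoint_sym BF.
  by rewrite cards0 !subn0.
have cE e : e \in U -> c e = 2.
  move=> eU; rewrite /c sum_incidence !inE.
  suff /andP[] : ((ends e).1 \in x :: p) && ((ends e).2 \in x :: p).
    by rewrite !inE => -> ->.
  by move: eU; rewrite !inE => /orP[/orP[/endF//|/endA[]//]|/endB[]//].
case/existsP: vz => a jvz.
have ca : c a = 1.
  rewrite /c sum_incidence !inE; case/orP: jvz => /eqP -> /=;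
  by move: vp zp; rewrite !inE => -> /negbTE ->.
have aU : a \notin U by apply/negP => /cE; rewrite ca.
have lowc : \sum_e c e >= #|U| * 2 + 1.
  rewrite (bigID (mem U)) /= leq_add //.
    by rewrite -sum_nat_const; apply: leq_sum => e /cE ->.
  by rewrite (bigD1 a) //= ca.
have lP : (x \in low_degree G) + (last x p \in low_degree G) <=
    \sum_(u in P) (u \in low_degree G).
  rewrite (bigD1 x) ?inE ?eqxx //= (bigD1 (last x p)) /= ?inE ?mem_last //.
    by rewrite addnA leq_addr.
  by rewrite -in_cons mem_last eq_sym.
have tot : \sum_(u : vert G) (degree u + 2 * (u \in low_degree G)) =
    #|edge G| * 2 + 2 * #|low_degree G|.
  have -> : #|low_degree G| = \sum_(u : vert G) (u \in low_degree G).
    by rewrite -sum1_card big_mkcond.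
  by rewrite big_split /= handshake -big_distrr.
have inP : \sum_(u in P) (degree u + 2 * (u \in low_degree G)) =
    \sum_e c e + 2 * \sum_(u in P) (u \in low_degree G).
  by rewrite big_split /= dP -big_distrr.
have outP : 2 * #|~: P| <= \sum_(u in ~: P) (degree u + 2 * (u \in low_degree G)).
  by rewrite mulnC -sum_nat_const; apply: leq_sum => u _; apply: degree_low_ge2.
(* Give each vertex its degree, plus two if it is of low degree. The path receives at least 2|P| + 3
   and the remaining vertices at least two each, so 2E + 2l >= 2V + 3, and parity improves this to E
   + l >= V + 2. *)
have := cardsC P.
have : \sum_(u : vert G) (degree u + 2 * (u \in low_degree G)) =
  \sum_(u in P) (degree u + 2 * (u \in low_degree G)) +
  \sum_(u in ~: P) (degree u + 2 * (u \in low_degree G)).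
  rewrite (bigID (mem P)) /=; congr (_ + _).
  by apply: eq_bigl => u; rewrite !inE.
move: cP cU lowc lP tot inP outP cA cB; clear.
move: (\sum_(u : vert G) _) (\sum_(u in P) (_ + _)) (\sum_(u in ~: P) _)%SET.
move: (\sum_e _) (\sum_(u in P) _) #|P| #|(~: P)%SET| #|U| #|A| #|B|.
move: (x \in _ : nat) (last x p \in _ : nat) #|edge G| #|vert G| #|low_degree G|.
lia.
Qed.

End LongestPath.

Lemma excess_of_nonhamiltonian (G : mgraph) (v0 : vert G) :
  connected_graph G -> ~ hamiltonian G ->
  #|vert G| + 2 <= #|edge G| + #|low_degree G|.
Proof.
move=> cG nH.
pose Q m := `[< exists y q, [/\ path (@adj G) y q, uniq (y :: q) & size q = m] >].
have exQ : exists m, Q m by exists 0; apply/asboolP; exists v0, [::].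
have bQ m : Q m -> m <= #|vert G|.
  by move=> /asboolP[y [q [_ /= /andP[_ /card_uniqP <-] <-]]]; apply: max_card.
have [m /asboolP[x [p [xp up sp]]] maxm] := ex_maxnP exQ bQ.
have [w wp] : exists w, w \notin x :: p.
  by apply: contrapT => h; apply: nH; exists x, p; split => // v;
     apply: contrapT => /negP vp; apply: h; exists v.
apply: (longest_path_excess cG xp up _ wp) => y q yq uq.
by rewrite sp; apply: maxm; apply/asboolP; exists y, q.
Qed.

(** * Behaviour of the counts, degrees and connectedness under subdivision *)

Section SubdivisionInvariants.
Variables (G : mgraph) (s : edge G -> nat).
Let G' := subdivide s.

Lemma subdiv_pointS (e : edge G) (j : 'I_(s e)) :
  subdiv_point s e j.+1 = inr (existT (fun e => 'I_(s e)) e j).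
Proof. by rewrite /= valK. Qed.

Lemma subdiv_point_last (e : edge G) : subdiv_point s e (s e).+1 = inl (ends e).2.
Proof. by rewrite /= insubF // ltnn. Qed.

Definition sub_edge (e : edge G) (i : 'I_(s e).+1) : edge G' :=
  existT (fun e => 'I_(s e).+1) e i.

Lemma ends_sub_edge e i :
  ends (@sub_edge e i) = (subdiv_point s e i, subdiv_point s e i.+1).
Proof. by []. Qed.

Lemma card_subdivide_edge : #|edge G'| = #|edge G| + \sum_e s e.
Proof.
rewrite card_tagged sumnE big_map big_enum /= -sum1_card -big_split /=.
by apply: eq_bigr => e _; rewrite card_ord.
Qed.

Lemma card_subdivide_vert : #|vert G'| = #|vert G| + \sum_e s e.
Proof.
rewrite card_sum card_tagged sumnE big_map big_enum /=.
by congr (_ + _); apply: eq_bigr => e _; rewrite card_ord.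
Qed.

Lemma degree_subdivide_old (v : vert G) : degree (inl v : vert G') = degree v.
Proof.
rewrite /degree.
rewrite -(@sig_big_dep _ _ _ _ (fun e => 'I_(s e).+1) predT (fun _ => predT)
  (fun e i => incidence (sub_edge i) (inl v))).
apply: eq_bigr => e _; rewrite /incidence.
under eq_bigr do rewrite ends_sub_edge.
(* First ends run over the points 0 to [s e], second ends over 1 to [(s e).+1]; only the points 0
   and [(s e).+1] are old vertices. *)
rewrite big_split /= big_ord_recl [X in _ + X]big_ord_recr.
rewrite /= big1 => [|i _]; last by rewrite /bump /= add0n valK.
by rewrite insubF ?ltnn // addn0 add0n.
Qed.

Lemma degree_subdivide_new (x : {e : edge G & 'I_(s e)}) :
  2 <= degree (inr x : vert G').
Proof.
case: x => e j; rewrite /degree.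
(* The new vertex with index [j] is the point [j.+1]: the piece [a] ends there and the next piece
   [b] starts there. *)
pose a : edge G' := sub_edge (widen_ord (leqnSn _) j).
pose b : edge G' := sub_edge (lift ord0 j).
have ab : b != a.
  apply/eqP => E.
  have : val (tagged b) = val (tagged a) by rewrite E.
  by move=> /= /eqP; rewrite /bump add1n; lia.
rewrite (bigD1 a) //= (bigD1 b) //= addnA.
apply: leq_trans (leq_addr _ _); rewrite /incidence.
have -> : (ends a).2 = inr (existT _ e j) := subdiv_pointS j.
have -> : (ends b).1 = inr (existT _ e j) := subdiv_pointS j.
by rewrite !eqxx; lia.
Qed.

Lemma card_low_degree_subdivide : #|low_degree G'| <= #|low_degree G|.
Proof.
rewrite -(card_imset (mem (low_degree G)) (@inl_inj _ {e : edge G & 'I_(s e)})).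
apply: subset_leq_card; apply/fintype.subsetP => -[v|x]; rewrite inE.
  by rewrite degree_subdivide_old => dv; apply: imset_f; rewrite inE.
by rewrite leqNgt degree_subdivide_new.
Qed.

(** Each point of a subdivided edge is reached by walking from the first end of that edge, and
    walking to the far end lifts adjacency in [G]. *)
Lemma connected_subdivide : connected_graph G -> connected_graph G'.
Proof.
move=> cG.
have point_step (e : edge G) i : i <= s e ->
    adj (subdiv_point s e i : vert G') (subdiv_point s e i.+1).
  rewrite -ltnS => ie; exact: (adj_ends (sub_edge (Ordinal ie))).
have point_connect (e : edge G) i : i <= (s e).+1 ->
    connect (@adj G') (inl (ends e).1) (subdiv_point s e i).
  elim: i => [|i IH] ie; first exact: connect0.
  apply: connect_trans (IH (ltnW ie)) _; apply: connect1; exact: point_step.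
have csym := sym_connect_sym (@adj_sym G').
have adj_connect u v : adj u v -> connect (@adj G') (inl u) (inl v).
  case/existsP=> e; have := point_connect e (s e).+1 (leqnn _).
  rewrite subdiv_point_last => h /orP[] /eqP E; rewrite E /= in h => //.
  by rewrite csym.
have old_connect u v : connect (@adj G') (inl u) (inl v).
  case/connectP: (cG u v) => p pp ->; elim: p u pp => [|y p IH] u /=.
    by move=> _; exact: connect0.
  by case/andP=> /adj_connect uy /IH; apply: connect_trans.
have to_old (z : vert G') : exists u, connect (@adj G') (inl u) z.
  case: z => [u|[e j]]; first by exists u; exact: connect0.
  by exists (ends e).1; rewrite -subdiv_pointS; apply: point_connect; rewrite ltnS ltnW.
move=> x y; have [u ux] := to_old x; have [v vy] := to_old y.
apply: connect_trans vy; apply: connect_trans (old_connect u v).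
by rewrite csym.
Qed.

End SubdivisionInvariants.

Lemma hamiltonian_iso (G H : mgraph) :
  mgraph_iso G H -> hamiltonian H -> hamiltonian G.
Proof.
case=> fv [fe [[gv fK gK] [ge feK geK] jE]] [x [p [xp up allp]]].
exists (gv x), (map gv p); split.
- rewrite path_map; apply: sub_path xp => u v /existsP[e juv].
  by apply: (@joins_adj _ (ge e)); rewrite -jE geK !gK.
- by rewrite -map_cons map_inj_uniq //; apply: can_inj gK.
- by move=> v; rewrite -map_cons -(fK v); apply: map_f.
Qed.

Lemma mgraph_iso_refl (G : mgraph) : mgraph_iso G G.
Proof. by exists id, id; split => //; exists id. Qed.

(** * The multigraph of a tangle is connected *)

Section TangleConnected.
Variables (R : realType) (T : topologicalType).
Hypothesis tangleT : is_tangle R T.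
Local Open Scope classical_set_scope.
Local Open Scope ring_scope.

(** The preimage of a point in each copy of [0, 1] is finite, hence closed, and the quotient
    topology transfers this to the tangle. *)
Lemma closed_point_tangle (x : T) : closed [set x].
Proof.
have [_ _ [m [q [_ inj opn]]]] := tangleT.
rewrite -[X in closed X]setCK; apply: open_closedC; apply/opn => // i.
apply/open_subspaceP.
exists (~` (q i @^-1` [set x] `&` `[0, 1])); last first.
  apply/seteqP; split => t /= [h t01]; split => //.
    by move=> e; apply: h.
  by move=> [e _]; apply: h.
apply: closed_openC; set B := (q i @^-1` _ `&` _).
apply: (accessible_finite_set_closed.1 (hausdorff_accessible (@Rhausdorff R))).
have [[s Bs]|nB] := pselect (exists s, B s); last first.
  by rewrite (_ : B = set0) // -subset0 => t Bt; apply: nB; exists t.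
(* Only endpoints are identified, so a fibre containing [s] lies in {s, 0, 1}. *)
apply: (@sub_finite_set _ _ [set s; 0; 1]); last first.
  by rewrite !finite_setU; do !split; exact: finite_set1.
move=> t [/= et t01]; have [/= es s01] := Bs.
have [] := inj i i s t s01 t01; first by rewrite es et.
  by case=> _ ->; left; left.
by case=> _ [->|->]; [left; right|right].
Qed.

Variables (G : mgraph) (fv : vert G -> T) (fe : edge G -> set T).
Hypotheses (bfv : set_bij [set: vert G] (@singular R T) fv)
  (bfe : set_bij [set: edge G] (@tangle_edges R T) fe).
Hypothesis endsE : forall e,
  closure (fe e) `\` fe e = [set fv (ends e).1; fv (ends e).2].

Let edge_component e : @tangle_edges R T (fe e).
Proof. by have [h _ _] := bfe; apply: h. Qed.

Let fe_nonsingular e x : fe e x -> ~ @singular R T x.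
Proof.
have [y yns <-] := edge_component e; exact: connected_component_sub.
Qed.

Let fv_singular v : @singular R T (fv v).
Proof. by have [h _ _] := bfv; apply: h. Qed.

Let fe_disjoint e e' x : fe e x -> fe e' x -> e = e'.
Proof.
move=> ex ex'; have [_ inj _] := bfe; apply: inj; rewrite ?in_setT //.
have [y _ ey] := edge_component e; have [z _ ez] := edge_component e'.
move: ex ex'; rewrite -ey -ez => /same_connected_component ->.
by move/same_connected_component ->.
Qed.

Let closure_edge e x :
  closure (fe e) x -> fe e x \/ x = fv (ends e).1 \/ x = fv (ends e).2.
Proof.
move=> cx; have [|nx] := pselect (fe e x); first by left.
by right; have : (closure (fe e) `\` fe e) x by []; rewrite endsE.
Qed.

(** The piece of the tangle spanned by [B]. Testing only the first end suffices because [B] will be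
    a union of components, which contains both ends of an edge or neither. *)
Let part (B : set (vert G)) : set T :=
  (\bigcup_(v in B) [set fv v]) `|`
  \bigcup_(e in [set e | B (ends e).1]) closure (fe e).

Let closed_part B : closed (part B).
Proof.
apply: closedU; apply: closed_bigcup => [|? _]; try exact: finite_finset.
  exact: closed_point_tangle.
exact: closed_closure.
Qed.

Let part_cover B : part B `|` part (~` B) = setT.
Proof.
rewrite -subTset => x _; have [sx|nsx] := pselect (@singular R T x).
  have [_ _ /(_ x sx)[v _ <-]] := bfv.
  by have [vB|vB] := pselect (B v); [left|right]; left; exists v.
have [_ _ sur] := bfe.
have [|e _ ex] := sur (connected_component (~` (@singular R T)) x); first by exists x.
have cx : closure (fe e) x.
  by apply: subset_closure; rewrite ex; apply: connected_component_refl.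
by have [vB|vB] := pselect (B (ends e).1); [left|right]; right; exists e.
Qed.

(** The closure of an edge adds only its end vertices, edges avoid singular points, and distinct
    edges are disjoint. *)
Let part_disjoint B : (forall e, B (ends e).1 <-> B (ends e).2) ->
  part B `&` part (~` B) = set0.
Proof.
move=> cB; have inj v v' : fv v = fv v' -> v = v'.
  by have [_ inj _] := bfv; apply: inj; rewrite in_setT.
have vertex C v : (forall e, C (ends e).1 <-> C (ends e).2) ->
    part C (fv v) -> C v.
  move=> cC [[w Cw /inj ->//]|[e Ce /closure_edge[/fe_nonsingular //|]]].
  by case=> /inj ->; rewrite // -cC.
have cB' e : (~` B) (ends e).1 <-> (~` B) (ends e).2.
  by split=> h k; apply: h; apply/cB.
rewrite -subset0 => x [px px'].
have [[w Bw xw]|[e Be /closure_edge ex]] := px.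
  by move: px'; rewrite xw => /(vertex _ _ cB').
case: ex => [ex|[] E]; last 2 first.
- by move: px'; rewrite E => /(vertex _ _ cB').
- by move: px'; rewrite E => /(vertex _ _ cB'); apply; apply/cB.
case: px' => [[w _ xw]|[e' Be' /closure_edge[ex'|ex']]].
- by apply: (fe_nonsingular ex); rewrite xw.
- by apply: Be'; rewrite -(fe_disjoint ex ex').
by apply: (fe_nonsingular ex); case: ex' => ->.
Qed.

Lemma inhabited_vert_of_tangle : inhabited (vert G).
Proof.
have [[x _] _ _] := tangleT.
have := part_cover setT; rewrite -subTset => /(_ x I).
by case=> -[[v _ _]|[e _ _]];
   first [exact: inhabits v | exact: inhabits (ends e).1].
Qed.

(** The component of [u] and its complement would split the tangle into two disjoint nonempty closed
    parts. *)
Lemma connected_graph_of_tangle : connected_graph G.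
Proof.
move=> u v; apply: contrapT => nuv.
pose B : set (vert G) := [set w | connect (@adj G) u w].
have cB e : B (ends e).1 <-> B (ends e).2.
  split=> h; apply: connect_trans h (connect1 _); last rewrite adj_sym;
  exact: adj_ends.
have [_ cT _] := tangleT.
have dB := part_disjoint cB; have vB := part_cover B.
have fvB : part B (fv u) by left; exists u => //; exact: connect0.
have : part B = setT.
  apply: cT; first by exists (fv u).
    exists (~` part (~` B)); first exact/closed_openC/closed_part.
    rewrite setTI; apply/seteqP; split=> x.
      by move=> px px'; rewrite -[False]/(@set0 T x) -dB.
    by move=> px; have : setT x by []; rewrite -vB => -[].
  by exists (part B); [exact: closed_part|rewrite setTI].
move=> BT; have : part B (fv v) by rewrite BT.
move=> pv; have : (part B `&` part (~` B)) (fv v) by split => //; left; exists v.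
by rewrite dB.
Qed.

End TangleConnected.

Lemma multigraph_of_connected (R : realType) (T : topologicalType) (G : mgraph) :
  is_tangle R T -> multigraph_of R T G ->
  inhabited (vert G) /\ connected_graph G.
Proof.
move=> tT [[_ [fv [fe [[gv fK gK] _ _]]]]|[fv [fe [bv be ee]]]].
  split=> [|u v]; first exact: inhabits (gv tt).
  by rewrite -(fK u) -(fK v); case: (fv u) (fv v) => -[]; exact: connect0.
split; [exact: inhabited_vert_of_tangle bv be|
           exact (connected_graph_of_tangle tT bv be ee)].
Qed.

(** * Labelling vertices by the edges of the base graph *)

Section Labelling.
Variable E : finType.

(* A vertex label [None] marks a branch vertex; the other labels say which edge
   of the base graph a vertex lies on. *)
Definition edge_labelling (K : mgraph) (lv : vert K -> option E)
    (le : edge K -> E) : Prop :=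
  forall a u v, joins a u v -> lv u = None \/ lv u = Some (le a).

Definition subdivide_lv (K : mgraph) (s : edge K -> nat) (lv : vert K -> option E)
    (le : edge K -> E) (x : vert (subdivide s)) : option E :=
  match x with inl v => lv v | inr y => Some (le (tag y)) end.

Definition subdivide_le (K : mgraph) (s : edge K -> nat) (le : edge K -> E)
    (a : edge (subdivide s)) : E := le (tag a).

Lemma edge_labelling_subdivide (K : mgraph) (s : edge K -> nat) lv le :
  edge_labelling lv le ->
  edge_labelling (@subdivide_lv K s lv le) (@subdivide_le K s le).
Proof.
move=> lab [e i].
have point j : subdivide_lv lv le (subdiv_point s e j) = None \/
    subdivide_lv lv le (subdiv_point s e j) = Some (le e).
  have hl : joins e (ends e).1 (ends e).2 by rewrite /joins -surjective_pairing eqxx.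
  have hr : joins e (ends e).2 (ends e).1.
    by rewrite /joins -surjective_pairing eqxx orbT.
  case: j => [|j] /=; first exact: lab hl.
  by case: insubP => [k _ _|_] /=; [right|exact: lab hr].
by move=> u v; rewrite /joins => /orP[/eqP[<- _]|/eqP[_ <-]]; 
  [exact: (point i)|exact: (point i.+1)].
Qed.

(** Label classes never shrink under subdivision, while the next lemma keeps the number of branch
    vertices fixed; this is how bounds for one graph pass to all its subdivisions. *)
Lemma card_label_subdivide (K : mgraph) (s : edge K -> nat) lv le c :
  #|[set v | lv v == c]| <= #|[set x | @subdivide_lv K s lv le x == c]|.
Proof.
rewrite -(card_imset _ (@inl_inj _ {e : edge K & 'I_(s e)})).
by apply: subset_leq_card; apply/fintype.subsetP => _ /imsetP[v + ->]; rewrite !inE.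
Qed.

Lemma card_none_subdivide (K : mgraph) (s : edge K -> nat) lv le :
  #|[set x | @subdivide_lv K s lv le x == None]| = #|[set v | lv v == None]|.
Proof.
rewrite -(card_imset [set v | lv v == None] (@inl_inj _ {e : edge K & 'I_(s e)})).
apply: eq_card => -[v|x]; rewrite !inE.
  by rewrite (mem_imset _ _ (@inl_inj _ _)) inE.
by apply/esym/imsetP => -[].
Qed.

Lemma edge_labelling_iso (K K' : mgraph) (fv : vert K -> vert K')
    (fe : edge K -> edge K') lv le :
  (forall e u v, joins (fe e) (fv u) (fv v) = joins e u v) ->
  edge_labelling lv le -> edge_labelling (lv \o fv) (le \o fe).
Proof. by move=> jE lab a u v; rewrite -jE => /lab. Qed.

Lemma card_label_iso (K K' : mgraph) (fv : vert K -> vert K')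
    (lv : vert K' -> option E) c : bijective fv ->
  #|[set v | (lv \o fv) v == c]| = #|[set v | lv v == c]|.
Proof.
move=> [gv fK gK]; rewrite -(card_imset _ (can_inj fK)); apply: eq_card => v.
by rewrite -{1}(gK v) (mem_imset _ _ (can_inj fK)) !inE /= gK.
Qed.

End Labelling.

Lemma card_edge_label_subdivide (G : mgraph) (s : edge G -> nat) lv e :
  s e <= #|[set x | @subdivide_lv _ G s lv id x == Some e]|.
Proof.
rewrite -{1}(card_ord (s e)) -cardsT.
have inj : injective (fun j : 'I_(s e) =>
    (inr (existT (fun e => 'I_(s e)) e j) : vert (subdivide s))).
  move=> i j [] /eqP; rewrite -tag_eqE /tag_eq eqxx /= tagged_asE => /eqP //.
rewrite -(card_imset _ inj); apply: subset_leq_card.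
by apply/fintype.subsetP => _ /imsetP[j _ ->]; rewrite inE /=.
Qed.

(* Vertices of degree at most one are put on their edge (an isolated vertex on
   any edge), since they do not separate anything. *)
Lemma base_labelling (G : mgraph) (e0 : edge G) :
  exists lv : vert G -> option (edge G),
    edge_labelling lv id /\ [set v | lv v == None] = (~: low_degree G)%SET.
Proof.
pose lv v := if degree v <= 1 then
  Some (odflt e0 [pick e | 0 < incidence e v]) else None.
exists lv; split; last first.
  by apply/finset.setP => v; rewrite !inE /lv; case: ifP.
move=> a u v jauv; rewrite /lv; case: ifP => du; [right|by left].
case: pickP => [e eu|/(_ a)] /=; last by rewrite (joins_incidence jauv).
(* If the picked edge differed from [a], two distinct edges would meet at [u], making its degree at
   least two. *)
congr Some; apply/eqP; apply: contraLR du => ea; rewrite -ltnNge /degree.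
rewrite (bigD1 a) //= (bigD1 e) //=.
by have := joins_incidence jauv; move: eu; lia.
Qed.

(** * Counting marks in the bundles of an allocation *)

Lemma sum_allocation (G : mgraph) n (A : 'I_n -> {set vert G}) (B : {set vert G}) :
  contiguous_allocation A -> \sum_i #|A i :&: B| = #|B|.
Proof.
case=> dis cov _; rewrite -sum1_card.
under eq_bigr do rewrite -sum1_card big_mkcond /=.
rewrite exchange_big [RHS]big_mkcond; apply: eq_bigr => v _ /=.
have [i vi] := cov v; rewrite (bigD1 i) //= inE vi /= big1 ?addn0 // => j ji.
rewrite inE; case vj: (v \in A j) => //=.
by have := dis j i ji => /finset.setP/(_ v); rewrite !inE vj vi.
Qed.

Lemma exists_marking (V E : finType) (lv : V -> option E) (w : E -> nat) :
  (forall e, w e <= #|[set v | lv v == Some e]|) ->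
  exists M : {set V}, forall e, #|M :&: [set v | lv v == Some e]| = w e.
Proof.
move=> hw; pose M e := take (w e) (enum [set v | lv v == Some e]).
exists [set v | if lv v is Some e then v \in M e else false] => e.
rewrite (@eq_card _ _ (mem (M e))); last first.
  move=> v; rewrite !inE; case lve: (lv v) => [f|] /=.
    case: eqP => [[->]|ne]; first by rewrite andbT.
    rewrite andbF; apply/esym/negP => /mem_take; rewrite mem_enum inE lve => /eqP [] ef.
    by apply: ne; rewrite ef.
  by apply/esym/negP => /mem_take; rewrite mem_enum inE lve.
have /card_uniqP -> : uniq (M e) by apply: take_uniq; apply: enum_uniq.
by rewrite size_take -cardE; case: ltngtP (hw e).
Qed.

Section FairDivisionFails.
Variables (R : realType) (K : mgraph) (E : finType).
Variables (lv : vert K -> option E) (le : edge K -> E).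
Hypothesis lab : edge_labelling lv le.

(** A walk can pass from one label to another only through a branch vertex. *)
Lemma connected_in_label (X : {set vert K}) x y :
  connected_in X -> (forall v, v \in X -> lv v != None) ->
  x \in X -> y \in X -> lv x = lv y.
Proof.
move=> /forallP /(_ x) /implyP cX nX xX yX.
have /forallP /(_ y) /implyP /(_ yX) /connectP[p pp ->] := cX xX.
elim: p x xX pp {cX} => //= z p IH x xX /andP[/and3P[/existsP[a j] _ zX] zp].
rewrite -(IH z) //; have jz : joins a z x by move: j; rewrite /joins orbC.
have := nX x xX; have := nX z zX.
by case: (lab j) (lab jz) => [->//|->] [->|->].
Qed.

(* With [n] identical agents counting marked vertices, every bundle holds at
   least [t] marks; a bundle without branch vertex has all of them on one edge,
   and the edge [e] carries too few marks for [(p e).+1] such bundles. *)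
Lemma not_guarantees_of_labelling (n k t : nat) (p : E -> nat) :
  0 < n -> 0 < t ->
  (forall e, (p e).+1 * t <= #|[set v | lv v == Some e]| + 1) ->
  #|[set v | lv v == None]| + \sum_e p e < n ->
  n * (t + k) <= \sum_e ((p e).+1 * t - 1) ->
  ~ guarantees_EFk_outer R K n k.
Proof.
move=> n0 t0 hw hp hs.
have [M hM] : exists M : {set vert K},
    forall e, #|M :&: [set v | lv v == Some e]| = (p e).+1 * t - 1.
  by apply: exists_marking => e; rewrite leq_subLR addnC.
pose nu (i : 'I_n) (X : {set vert K}) : R := (#|X :&: M|%:R)%R.
case/(_ nu).
  move=> i; split; first by rewrite /nu finset.set0I cards0.
  by move=> X Y XY; rewrite /nu ler_nat subset_leq_card // finset.setSI.
move=> A [allocA EFA]; have [_ _ conA] := allocA.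
have cM : \sum_e ((p e).+1 * t - 1) <= #|M|.
  under eq_bigr do rewrite -hM -sum1_card big_mkcond /=.
  rewrite exchange_big -sum1_card [leqRHS]big_mkcond /=; apply: leq_sum => v _.
  case lve: (lv v) => [e|].
    rewrite (bigD1 e) //= big1 ?addn0; last first.
      by move=> f fe; rewrite !inE lve (inj_eq Some_inj) eq_sym (negbTE fe) andbF.
    by rewrite inE; case: (v \in M) => //=; case: (_ \in _).
  by rewrite big1 // => e _; rewrite !inE lve andbF.
(* Averaging: if all [n] bundles held at most t + k - 1 marks, there would be fewer than n(t + k) in
   total. *)
have [j vj] : exists j, t + k <= #|A j :&: M|.
  apply: contrapT => h.
  have : \sum_(i < n) #|A i :&: M| <= \sum_(i < n) (t + k).-1.
    apply: leq_sum => i _; have : ~ t + k <= #|A i :&: M| by move=> ?; apply: h; exists i.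
    lia.
  rewrite sum_allocation // sum_nat_const card_ord; nia.
(* Removing at most [k] vertices from bundle [j] leaves at least [t] marks, and agent [i] does not
   envy what is left. *)
have vi i : t <= #|A i :&: M|.
  have [->|ij] := eqVneq i j; first lia.
  have [S [SA Sk _]] := EFA i j ij; rewrite /nu ler_nat.
  have : #|A j :&: M| <= #|(A j :\: S) :&: M| + #|S|.
    rewrite -(cardsID S (A j :&: M)) addnC leq_add //.
      by apply: subset_leq_card; apply/fintype.subsetP => v; rewrite !inE => /and3P[-> -> ->].
    by apply: subset_leq_card; apply/fintype.subsetP => v; rewrite !inE => /andP[_ ->].
  lia.
(* Each bundle is charged to a branch vertex it contains or to an edge on which it holds at least
   [t] marks. *)
have type i : 1 <= #|A i :&: [set v | lv v == None]| +
    \sum_e (t <= #|A i :&: (M :&: [set v | lv v == Some e])|).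
  have [/eqP|//] := posnP #|A i :&: [set v | lv v == None]|; last first.
    by move=> h; apply: ltn_addr.
  rewrite cards_eq0 => /eqP A0; apply: ltn_addl.
  have nA v : v \in A i -> lv v != None.
    by move=> vA; apply/negP => h; have := finset.in_set0 v; rewrite -A0 !inE vA h.
  have /card_gt0P[x] : 0 < #|A i :&: M| by apply: leq_trans (vi i).
  rewrite inE => /andP[xA xM]; case lx: (lv x) (nA x xA) => [e|//] _.
  rewrite (bigD1 e) //= ltn_addr // lt0b; apply: leq_trans (vi i) _.
  apply: subset_leq_card; apply/fintype.subsetP => y; rewrite !inE => /andP[yA ->].
  by rewrite yA -(connected_in_label (conA i) nA xA yA) lx /=.
have : \sum_(i < n) 1 <= #|[set v | lv v == None]| + \sum_e p e.
  apply: (@leq_trans (\sum_(i < n) (#|A i :&: [set v | lv v == None]| +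
    \sum_e (t <= #|A i :&: (M :&: [set v | lv v == Some e])|)))).
    by apply: leq_sum => i _; exact: type.
  rewrite big_split /= sum_allocation // leq_add2l exchange_big /=.
  apply: leq_sum => e _.
  (* Bundles charged to [e] use [t] marks each, and (p e + 1)t - 1 marks allow at most [p e] of
     them. *)
  have : t * \sum_(i < n) (t <= #|A i :&: (M :&: [set v | lv v == Some e])|) <=
      (p e).+1 * t - 1.
    rewrite -hM -(sum_allocation _ allocA) big_distrr /=; apply: leq_sum => i _.
    by case: (leqP t) => //= ?; rewrite ?muln1 ?muln0.
  move=> h; rewrite -ltnS -(ltn_pmul2l t0); apply: leq_ltn_trans h _.
  by rewrite [t * _]mulnC subn1 ltn_predL muln_gt0.
by rewrite sum_nat_const card_ord muln1 => h; have := leq_trans hp h; rewrite ltnn.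
Qed.

End FairDivisionFails.

(** * From a non-Hamiltonian member to a subdivision without fair allocations *)

(** Subdividing adds equally many edges and vertices and creates no vertex of low degree, so the
    excess inequality descends to [G]. *)
Lemma topological_class_excess (R : realType) (T : topologicalType) (K : mgraph) :
  is_tangle R T -> topological_class R T K -> ~ hamiltonian K ->
  exists G, [/\ multigraph_of R T G, #|~: low_degree G| + 2 <= #|edge G| &
    inhabited (edge G)].
Proof.
move=> tT [G mG [s isoK]] nK; exists G.
have [[v] cG] := multigraph_of_connected tT mG.
have nH : ~ hamiltonian (subdivide s) by move/(hamiltonian_iso isoK).
have := excess_of_nonhamiltonian (inl v : vert (subdivide s)) (connected_subdivide cG) nH.
rewrite card_subdivide_edge card_subdivide_vert.
have := card_low_degree_subdivide s; have := cardsC (low_degree G) => cC lowG exG.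
have exc : #|~: low_degree G| + 2 <= #|edge G| by lia.
split; [exact: mG|exact: exc|]; have /card_gt0P[e _] : 0 < #|edge G| by lia.
by constructor.
Qed.

Theorem theorem9p1 (R : realType) (T : topologicalType)
  (tangleT : is_tangle R T)
  (nonHam : exists K : mgraph, topological_class R T K /\ ~ hamiltonian K) :
  exists n1 : nat, (0 < n1)%N /\
    forall n k : nat, (n1 < n)%N -> (1 <= k)%N ->
      eventually_all R T (fun K => ~ guarantees_EFk_outer R K n k).
Proof.
have [K0 [cK0 nK0]] := nonHam.
have [G [mG exG [e0]]] := topological_class_excess tangleT cK0 nK0.
(* This bound gives c <= n - 1, so the truncated subtraction n - 1 - c below is exact. *)
exists #|vert G|.+1; split => // n k n1n _.
have [lv [lab lvN]] := base_labelling e0.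
pose c := #|~: low_degree G|; have cV : c <= #|vert G| by apply: max_card.
(* The total number of marks is (n - 1 - c + E)t - E, where E >= c + 2; hence it is at least (n +
   1)t - E, which equals n(t + k) for this [t]. *)
pose t := n * k + #|edge G|.
(* Only the sum of [p] matters, so it is all placed on [e0]. *)
pose p (e : edge G) := if e == e0 then n - 1 - c else 0.
have sp : \sum_e p e = n - 1 - c.
  by rewrite (bigD1 e0) //= /p eqxx big1 ?addn0 // => e /negbTE ->.
pose s (e : edge G) := (p e).+1 * t.
have t0 : 0 < t by rewrite /t; lia.
exists (subdivide s); first by exists G => //; exists s; exact: mgraph_iso_refl.
move=> K _ [s' [fv [fe [bfv _ jE]]]].
have labK := edge_labelling_iso jE
  (edge_labelling_subdivide (s := s') (edge_labelling_subdivide (s := s) lab)).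
apply: (not_guarantees_of_labelling labK (t := t) (p := p)) => //; first by lia.
- move=> e; rewrite card_label_iso // addn1 ltnW // ltnS.
  by apply: leq_trans (card_label_subdivide _ _ _ _); exact: card_edge_label_subdivide.
- by rewrite card_label_iso // !card_none_subdivide lvN sp -/c; lia.
(* Adding one per edge removes the truncated subtractions from the total. *)
have : \sum_e ((p e).+1 * t - 1) + #|edge G| = (\sum_e p e + #|edge G|) * t.
  rewrite -sum1_card -!big_split big_distrl /=; apply: eq_bigr => e _.
  by rewrite subnK ?addn1 // muln_gt0.
by rewrite sp; move: exG cV n1n; rewrite /t -/c; nia.
Qed.
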